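(* Let $n\ge 2$ and $\mu=1$, and let $\omega\in\mathbb R$. The moment system $$\sum_{j=1}^n X_j z_j^{l}=\sigma_l,\qquad l=-n+1,\dots,n,\qquad \sigma_0=\omega,\ \ \sigma_{1}=\sigma_{-1}=1,\ \ \sigma_l=0\ \text{ for } l\ne 0,\pm1$$ (the equation with $\sigma_{-1}$ being present since $n\ge 2$) has a regular solution $\{X_j\},\{z_j\}$ (and hence the problem of extracting the first harmonic has a regular admissible solution with $\sum_j X_j=\omega$) if and only if $\omega\in\Omega_{n+1}$, where $$\Omega_{n+1}=\left\{2\cos\frac{\pi\alpha}{n+2}:\ \alpha=1,\dots,n+1\right\}.$$ Moreover, for $\omega=-2\cos\varphi_\alpha$, where $\varphi_\alpha=\frac{\pi\alpha}{n+2}$, $\alpha\in\{1,\dots,n+1\}$, the numbers $z_k$ $(k=1,\dots,n)$ of the solution form the set $$\{z_k\}=\{t\in\mathbb C:\ t^{n+2}=(-1)^{\alpha}\}\setminus\{e^{i\varphi_\alpha},e^{-i\varphi_\alpha}\},$$ and $$X_k=-\frac{\operatorname{sgn}(\sin((n+1)\varphi_\alpha))}{n+2}\cdot\frac{z_k^2-2z_k\cos\varphi_\alpha+1}{z_k^{n+3}},\qquad k=1,\dots,n.$$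
   Context: A solution $\{X_j\}_{j=1}^n,\{z_j\}_{j=1}^n$ of the moment system is called regular if all $z_j\in\mathbb C$ are pairwise distinct with $|z_j|=1$ and all $X_j\in\mathbb C$ are nonzero. Problem of extracting the $\mu$-th harmonic ($1\le\mu\le n$): find $X_j,\lambda_j$, $j=1,\dots,n$, such that $$\tau_\mu(x)=\sum_{j=1}^n X_j\,T_n(x-\lambda_j)$$ for every real trigonometric polynomial $T_n(x)=\sum_{k=1}^n\tau_k(x)$, $\tau_k(x)=a_k\cos kx+b_k\sin kx$, $a_k,b_k\in\mathbb R$. A solution is admissible if the $X_j,\lambda_j$ are real and do not depend on $T_n$; it is regular if in addition all $e^{i\lambda_j}$ are pairwise distinct and all $X_j\neq0$. The two problems are related by $z_j=e^{-i\lambda_j}$. Here the first harmonic is the case $\mu=1$. *)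

(* Defs.v *)
(* The reals are an arbitrary R : realType, the complex
   numbers are R[i]. Families indexed by 1, ..., n are functions on 'I_n. *)
From mathcomp Require Import all_boot all_order all_algebra.
From mathcomp Require Import complex.
From mathcomp Require Import classical_sets reals trigo.
Set Implicit Arguments.
Unset Strict Implicit.
Unset Printing Implicit Defensive.
Import Order.TTheory GRing.Theory Num.Theory.
Local Open Scope classical_set_scope.
Local Open Scope ring_scope.
Local Open Scope complex_scope.

(* e^{i x} for real x. *)
Definition expi (R : realType) (x : R) : R[i] := cos x +i* sin x.

(* sigma_0 = omega, sigma_{mu} = sigma_{-mu} = 1, and 0 otherwise (mu >= 1). *)
Definition harmonic_moment (R : realType) (mu : nat) (omega : R) (l : int) :
    R[i] :=
  if l == 0 then omega%:C else if `|l|%N == mu then 1 else 0.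

(* The exponent l is an integer; z j ^ l is a genuine power with negative
   exponents as soon as z j != 0, which holds for regular solutions. *)
Definition moment_solution (R : realType) (n : nat) (sigma : int -> R[i])
    (X z : 'I_n -> R[i]) : Prop :=
  forall l : int, 1 - n%:Z <= l -> l <= n%:Z ->
    \sum_(j < n) X j * z j ^ l = sigma l.

Definition regular_moment_solution (R : realType) (n : nat)
    (sigma : int -> R[i]) (X z : 'I_n -> R[i]) : Prop :=
  [/\ moment_solution sigma X z, injective z,
      forall j, `|z j| = 1 & forall j, X j != 0].

Definition harmonic (R : realType) (a b : nat -> R) (k : nat) (x : R) : R :=
  a k * cos (k%:R * x) + b k * sin (k%:R * x).

(* Only the coefficients a k, b k with 1 <= k <= n matter. *)
Definition trig_poly (R : realType) (n : nat) (a b : nat -> R) (x : R) : R :=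
  \sum_(1 <= k < n.+1) harmonic a b k x.

(* X and lam are real and chosen before the polynomial (a, b). *)
Definition admissible_extraction (R : realType) (n mu : nat)
    (X lam : 'I_n -> R) : Prop :=
  forall (a b : nat -> R) (x : R),
    harmonic a b mu x = \sum_(j < n) X j * trig_poly n a b (x - lam j).

Definition regular_admissible_extraction (R : realType) (n mu : nat)
    (X lam : 'I_n -> R) : Prop :=
  [/\ admissible_extraction mu X lam, injective (fun j => expi (lam j))
    & forall j, X j != 0].

(* Omega_N, with denominator N + 1 (so that Omega_{n+1} has denominator n + 2). *)
Definition Omega (R : realType) (N : nat) : set R :=
  [set 2 * cos (pi * alpha%:R / N.+1%:R)
    | alpha in [set alpha : nat | (1 <= alpha <= N)%N]].

(* Main.v *)
Require Import Defs.
From mathcomp Require Import all_boot all_order all_algebra.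
From mathcomp Require Import complex.
From mathcomp Require Import classical_sets reals trigo.
From mathcomp Require Import zify ring lra.
Import Order.TTheory GRing.Theory Num.Theory.
Local Open Scope classical_set_scope.
Local Open Scope ring_scope.
Local Open Scope complex_scope.

(** Let [z_1, ..., z_n] be the nodes of a regular solution, [P] the monic
    polynomial with these roots and [N = n + 2].

    Necessity. The moments are real and even in [l], and [z^-1] is the
    conjugate of [z] on the unit circle. Conjugating the system therefore gives
    a second set of weights on the same nodes, and [n] consecutive moments
    determine the weights, so the weights are real and the equation [l = - n]
    holds too ([regular_moment_window]). Pairing the shifted moments with [P]
    gives the recurrence [p_(s-1) + omega p_s + p_(s+1) = 0] for [0 <= s <= n],
    that is,
      [P (X^2 + omega X + 1) = X^N + p_0]   ([node_poly_mul]).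
    Both roots [w, 1/w] of the quadratic factor thus have [N]-th power [- p_0],
    so [p_0 ^ 2 = 1] and [w] is on the unit circle; [w <> 1/w] because
    [X^N + p_0] has simple roots. Writing [w = e^(i t)], the number [N t] is a
    multiple of [pi] and [omega = - 2 cos t] ([regular_moment_Omega]).

    The same factorization identifies the nodes as the roots of
    [X^N - (-1)^alpha] other than [w] and [1/w] ([regular_moment_nodes]).
    Pairing the moments with [\sum_(m < N) (x / z_k)^m], which vanishes at all
    the other nodes, gives [X_k = (z_k + omega + 1 / z_k) / N]
    ([moment_weight]); this is the stated formula once
    [z_k ^ N = (-1)^alpha] and [sin (N phi - phi) = - (-1)^alpha sin phi] are
    substituted.

    Sufficiency. For [omega = - 2 cos (pi alpha / N)], the weights
    [(t + omega + 1/t) / N] on all the solutions [t] of [t^N = (-1)^alpha] have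
    the required moments, because the power sums of these [t] vanish for
    exponents strictly between [0] and [N] in absolute value; the weights are
    zero exactly at [e^(i pi alpha / N)] and its inverse
    ([real_moment_solution]). These weights are real, and for real weights the
    extraction problem is equivalent to the moment system
    ([extraction_moment_solution]). *)

Set Implicit Arguments.
Unset Strict Implicit.
Unset Printing Implicit Defensive.

(** * The unit circle *)

Lemma expi0 (R : realType) : expi (0 : R) = 1.
Proof. by rewrite /expi cos0 sin0. Qed.

Lemma expiD (R : realType) (x y : R) : expi (x + y) = expi x * expi y.
Proof.
apply/eqP; rewrite eq_complex /= cosD sinD eqxx /=; apply/eqP; ring.
Qed.

Lemma expiNr (R : realType) (x : R) : expi (- x) * expi x = 1.
Proof. by rewrite -expiD addNr expi0. Qed.

Lemma expi_neq0 (R : realType) (x : R) : expi x != 0.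
Proof.
apply/eqP => e; have := expiNr x; rewrite e mulr0 => /esym/eqP.
by rewrite oner_eq0.
Qed.

Lemma expiN (R : realType) (x : R) : expi (- x) = (expi x)^-1.
Proof. by apply: (mulIf (expi_neq0 x)); rewrite expiNr mulVf ?expi_neq0. Qed.

Lemma conjc_expi (R : realType) (x : R) : (expi x)^* = expi (- x).
Proof. by rewrite /expi cosN sinN. Qed.

Lemma norm_expi (R : realType) (x : R) : `|expi x| = 1.
Proof. by rewrite normc_def /= cos2Dsin2 sqrtr1. Qed.

Lemma expiMn (R : realType) (k : nat) (x : R) :
  expi (k%:R * x) = expi x ^+ k.
Proof.
elim: k => [|k IH]; first by rewrite mul0r expi0 expr0.
by rewrite -addn1 natrD mulrDl mul1r expiD IH exprD expr1.
Qed.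

Lemma expi_pi (R : realType) : expi (pi : R) = -1.
Proof.
by apply/eqP; rewrite /expi cospi sinpi eq_complex /= oppr0 !eqxx.
Qed.

Lemma expiDN (R : realType) (x : R) :
  expi x + (expi x)^-1 = (2 * cos x)%:C.
Proof.
rewrite -expiN; apply/eqP; rewrite eq_complex /= cosN sinN subrr eqxx andbT.
by apply/eqP; ring.
Qed.

Lemma expi_double_neq1 (R : realType) (x : R) :
  0 < x < pi -> expi (2 * x) != 1.
Proof.
move=> hx; apply/eqP => /(congr1 (@complex.Re R)) /=.
have := cos2Dsin2 x; rewrite mulr_natl cos_mulr2n.
have := sin_gt0_pi hx; nra.
Qed.

Lemma unit_circle_arg (R : realType) (z : R[i]) : `|z| = 1 ->
  exists2 t : R, 0 <= t <= pi & z = expi t \/ z = expi (- t).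
Proof.
case: z => a b hz; have hab : a ^+ 2 + b ^+ 2 = 1.
  have := add_Re2_Im2 (a +i* b); rewrite hz expr1n /= => /eqP.
  by rewrite eq_complex /= => /andP[/eqP].
have ha : -1 <= a <= 1 by apply/andP; split; nra.
have cE : cos (acos a) = a by apply: acosK; rewrite in_itv.
exists (acos a); first by rewrite acos_ge0 // acos_lepi.
have : (b - sin (acos a)) * (b + sin (acos a)) = 0.
  by rewrite -subr_sqr sin2cos2 cE -hab; ring.
move/eqP; rewrite mulf_eq0 subr_eq0 addr_eq0 => /orP[]/eqP ->.
  by left; rewrite /expi cE.
by right; rewrite /expi cosN sinN cE.
Qed.

(** If [e^(i N t)] is real, then [N t] is an integral multiple of [pi]; when
    [0 <= t <= pi] the factor is between [0] and [N]. *)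
Lemma expi_exp_real (R : realType) (N : nat) (t : R) : (0 < N)%N ->
  0 <= t <= pi -> sin (N%:R * t) = 0 ->
  exists2 k : nat, (k <= N)%N & t = pi * k%:R / N%:R.
Proof.
move=> N0 /andP[t0 tpi] hs.
have pi0 := pi_gt0 R.
have NR0 : 0 < (N%:R : R) by rewrite ltr0n.
set y := N%:R * t / pi.
have y0 : 0 <= y by rewrite divr_ge0 ?mulr_ge0 // ?(ltW NR0) ?(ltW pi0).
have /andP[ky yk] := truncn_itv y0; set k := Num.truncn y in ky yk.
have yE : N%:R * t = y * pi by rewrite divfK ?gt_eqF.
have r0 : N%:R * t - k%:R * pi = 0.
  apply/eqP/negPn/negP => nz.
  have r_gt0 : 0 < N%:R * t - k%:R * pi.
    by rewrite lt_def nz subr_ge0 yE ler_pM2r.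
  have r_lt : N%:R * t - k%:R * pi < pi.
    by rewrite ltrBlDr yE -[X in X + _]mul1r -mulrDl nat1r ltr_pM2r.
  have : 0 < sin (N%:R * t - k%:R * pi) by rewrite sin_gt0_pi // r_gt0.
  have hk : sin (k%:R * pi) = 0 :> R.
    have : (expi (k%:R * pi : R)) = ((-1) ^+ k)%:C.
      by rewrite expiMn expi_pi rmorphXn /= rmorphN1.
    by move=> /(congr1 (@complex.Im R)).
  by rewrite sinB hs hk mul0r mulr0 subrr ltxx.
have tE : t = pi * k%:R / N%:R.
  apply: (mulfI (lt0r_neq0 NR0)); move/eqP: r0; rewrite subr_eq0 => /eqP ->.
  by field; rewrite gt_eqF.
exists k => //; rewrite -(ler_nat R).
move: tpi; rewrite tE ler_pdivrMr // ler_pM2l //.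
Qed.

(** * Pairing moments with polynomials *)

Lemma sum_mul_delta (F : pzRingType) (d s : nat) (f : nat -> F) :
  \sum_(m < d) f m * (m == s :> nat)%:R = if (s < d)%N then f s else 0.
Proof.
case: ltnP => hs; last first.
  by apply: big1 => m _; rewrite ltn_eqF ?mulr0 // (leq_trans (ltn_ord m)).
rewrite (bigD1 (Ordinal hs)) //= eqxx mulr1 big1 ?addr0 // => m.
by rewrite -val_eqE /= => /negPf->; rewrite mulr0.
Qed.

Lemma harmonic_moment1E (R : realType) (omega : R) (m s : nat) :
  harmonic_moment 1 omega (m%:Z - s%:Z) =
  (m.+1 == s)%:R + omega%:C * (m == s)%:R + (m == s.+1)%:R.
Proof.
rewrite /harmonic_moment; case: ifPn => [/eqP h|h].
  have -> : m = s by lia.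
  have -> : (s.+1 == s) = false by lia.
  have -> : (s == s.+1) = false by lia.
  by rewrite eqxx mulr1 add0r addr0.
have -> : (m == s) = false by lia.
rewrite mulr0 addr0; case: ifPn => h1.
  have [e|e] : m.+1 = s \/ m = s.+1 by lia.
    have -> : (m == s.+1) = false by lia.
    by rewrite e eqxx addr0.
  have -> : (m.+1 == s) = false by lia.
  by rewrite e eqxx add0r.
have -> : (m == s.+1) = false by lia.
have -> : (m.+1 == s) = false by lia.
by rewrite addr0.
Qed.

(** Pairing the sequence [f], read as the coefficients of a polynomial of
    degree less than [d], with the moments shifted by [s]: the result is the
    coefficient of degree [s + 1] in [f (X^2 + omega X + 1)]. *)
Lemma sum_harmonic_moment1 (R : realType) (omega : R) (d s : nat)
    (f : nat -> R[i]) : (s < d)%N -> f d = 0 ->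
  \sum_(m < d) f m * harmonic_moment 1 omega (m%:Z - s%:Z) =
  (if s is s'.+1 then f s' else 0) + omega%:C * f s + f s.+1.
Proof.
move=> hs fd.
under eq_bigr => m _ do rewrite harmonic_moment1E !mulrDr mulrCA.
rewrite !big_split /= -mulr_sumr !sum_mul_delta hs; congr (_ + _ + _).
  case: s hs => [|s] hs; first by apply: big1 => m _; rewrite mulr0.
  under eq_bigr => m _ do rewrite eqSS.
  by rewrite sum_mul_delta ltnW.
by case: ltnP => // h; have -> : s.+1 = d by lia.
Qed.

(** Pairing the moments [sigma a, ..., sigma (a + d - 1)] with a polynomial
    of degree less than [d]. *)
Lemma moment_horner (F : fieldType) (n d : nat) (X z : 'I_n -> F)
    (sigma : int -> F) (a : int) (f : {poly F}) :
  (forall j, z j != 0) ->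
  (forall m : nat, (m < d)%N ->
     \sum_(j < n) X j * z j ^ (m%:Z + a) = sigma (m%:Z + a)) ->
  (size f <= d)%N ->
  \sum_(j < n) X j * z j ^ a * f.[z j] = \sum_(m < d) f`_m * sigma (m%:Z + a).
Proof.
move=> z0 hX hf.
under [RHS]eq_bigr => m _ do rewrite -hX // mulr_sumr.
rewrite exchange_big /=; apply: eq_bigr => j _.
rewrite (horner_coef_wide _ hf) mulr_sumr; apply: eq_bigr => m _.
by rewrite expfzDr // -exprnP; ring.
Qed.

(** The monic polynomial whose roots are the nodes. *)
Definition node_poly (F : fieldType) (n : nat) (z : 'I_n -> F) : {poly F} :=
  \prod_(j < n) ('X - (z j)%:P).

Lemma size_node_poly (F : fieldType) (n : nat) (z : 'I_n -> F) :
  size (node_poly z) = n.+1.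
Proof. by rewrite size_prod_XsubC /index_enum -enumT size_enum_ord. Qed.

Lemma root_node_poly (F : fieldType) (n : nat) (z : 'I_n -> F) (t : F) :
  root (node_poly z) t = [exists j, t == z j].
Proof.
rewrite /root horner_prod; apply/prodf_eq0/existsP => -[j].
  by move=> _; rewrite hornerXsubC subr_eq0 => h; exists j.
by move=> h; exists j => //; rewrite hornerXsubC subr_eq0.
Qed.

(** Weights on [n] distinct nodes are determined by [n] consecutive moments
    (non-vanishing of the Vandermonde determinant). *)
Lemma moment_inj (F : fieldType) (n : nat) (Y z : 'I_n -> F) (a : int) :
  injective z -> (forall j, z j != 0) ->
  (forall m : nat, (m < n)%N -> \sum_(j < n) Y j * z j ^ (m%:Z + a) = 0) ->
  forall j, Y j = 0.
Proof.
move=> injz z0 hY k.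
(* The polynomial vanishing at all the nodes except [z k]. *)
pose f := \prod_(j < n | j != k) ('X - (z j)%:P).
have hf : (size f <= n)%N.
  have [->|f0] := eqVneq f 0; first by rewrite size_poly0.
  have := size_node_poly z; rewrite /node_poly (bigD1 k) //= -/f.
  by rewrite size_mul ?polyXsubC_eq0 // size_XsubC add2n => -[->].
have : \sum_(j < n) Y j * z j ^ a * f.[z j] = 0.
  rewrite (moment_horner (sigma := fun=> 0) z0 hY hf) big1 // => m _.
  exact: mulr0.
rewrite (bigD1 k) //= big1 => [|j jk]; last first.
  suff -> : f.[z j] = 0 by rewrite mulr0.
  by apply/eqP; rewrite /f horner_prod; apply/prodf_eq0; exists j => //;
    rewrite hornerXsubC subrr.
rewrite addr0 => /eqP; rewrite !mulf_eq0 expfz_eq0 (negPf (z0 k)) andbF orbF.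
case/orP=> [/eqP//|]; rewrite /f horner_prod => /prodf_eq0[j jk].
by rewrite hornerXsubC subr_eq0 => /eqP/injz kj; rewrite kj eqxx in jk.
Qed.

(** * The node polynomial of a regular solution *)

Lemma conjc_exprz (R : realType) (z : R[i]) (l : int) :
  `|z| = 1 -> (z ^ l)^* = z ^ (- l).
Proof.
move=> hz.
have z0 : z != 0 by rewrite -normr_eq0 hz oner_eq0.
have e : z^* = z^-1.
  by apply: (mulfI z0); rewrite -sqr_normc hz expr1n divff.
rewrite -exprz_inv -e; case: l => m.
  by rewrite /= rmorphXn.
by rewrite NegzE -exprnN fmorphV /= rmorphXn.
Qed.

Lemma harmonic_momentN (R : realType) (omega : R) (mu : nat) (l : int) :
  harmonic_moment mu omega (- l) = harmonic_moment mu omega l.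
Proof. by rewrite /harmonic_moment oppr_eq0 abszN. Qed.

Lemma conjc_harmonic_moment (R : realType) (omega : R) (mu : nat) (l : int) :
  (harmonic_moment mu omega l)^* = harmonic_moment mu omega l.
Proof.
by rewrite /harmonic_moment; do 2?case: ifP => _;
  rewrite ?conjc_real ?conjc1 ?conjc0.
Qed.

(** Since the moments are real and symmetric, conjugation turns a solution on
    the unit circle into another set of weights for the same nodes, satisfying
    the equations [-n <= l <= n - 1]; uniqueness makes the weights real, and
    the equation [l = -n] comes for free. *)
Lemma regular_moment_window (R : realType) (n mu : nat) (omega : R)
    (X z : 'I_n -> R[i]) : (0 < n)%N ->
  regular_moment_solution (harmonic_moment mu omega) X z ->
  forall l : int, - n%:Z <= l -> l <= n%:Z ->
    \sum_(j < n) X j * z j ^ l = harmonic_moment mu omega l.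
Proof.
move=> n0 [hX injz nz _].
have z0 j : z j != 0 by rewrite -normr_eq0 nz oner_eq0.
have hXc l : - n%:Z <= l -> l <= n%:Z - 1 ->
    \sum_(j < n) (X j)^* * z j ^ l = harmonic_moment mu omega l.
  move=> l1 l2; rewrite -harmonic_momentN -conjc_harmonic_moment.
  rewrite -hX; [|lia..]; rewrite rmorph_sum /=; apply: eq_bigr => j _.
  by rewrite rmorphM /= conjc_exprz ?nz // opprK.
have Xreal j : X j = (X j)^*.
  apply/eqP; rewrite -subr_eq0; apply/eqP.
  apply: (@moment_inj _ _ (fun j => X j - (X j)^*) z (1 - n%:Z)) => // m mn.
  under eq_bigr => i _ do rewrite mulrBl.
  by rewrite sumrB hX ?hXc ?subrr //; lia.
move=> l l1 l2; have [e|e] : l = n%:Z \/ l <= n%:Z - 1 by lia.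
  by rewrite hX //; lia.
by rewrite -hXc //; apply: eq_bigr => j _; congr (_ * _); exact: Xreal.
Qed.

(** The moment system forces a three-term recurrence on the coefficients of
    the node polynomial [P], which says that [P (X^2 + omega X + 1)] has no
    coefficient in degrees [1, ..., n + 1]. *)
Lemma node_poly_mul (R : realType) (n : nat) (omega : R) (X z : 'I_n -> R[i]) :
  (0 < n)%N -> regular_moment_solution (harmonic_moment 1 omega) X z ->
  node_poly z * ('X^2 + omega%:C *: 'X + 1) =
  'X^(n.+2) + ((node_poly z)`_0)%:P.
Proof.
move=> n0 hreg; have hw := regular_moment_window n0 hreg.
have [_ _ nz _] := hreg.
have z0 j : z j != 0 by rewrite -normr_eq0 nz oner_eq0.
set P := node_poly z.
have szP : size P = n.+1 := size_node_poly z.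
have P0 i : (n < i)%N -> P`_i = 0 by move=> ni; rewrite nth_default ?szP.
have Pn : P`_n = 1.
  by have /monicP := monic_prod_XsubC (index_enum 'I_n) xpredT z;
    rewrite lead_coefE -/(node_poly z) -/P szP.
have rec s : (s <= n)%N ->
    (if s is s'.+1 then P`_s' else 0) + omega%:C * P`_s + P`_s.+1 = 0.
  move=> sn; rewrite -(@sum_harmonic_moment1 _ _ n.+1 s (fun i => P`_i)) ?P0 //.
  rewrite -(@moment_horner _ n n.+1 X z _ (- s%:Z) P z0) ?szP //.
    apply: big1 => j _; suff -> : P.[z j] = 0 by rewrite mulr0.
    by apply/eqP; rewrite -/(root _ _) root_node_poly; apply/existsP; exists j.
  by move=> m mn; apply: hw; lia.
apply/polyP => i; rewrite !mulrDr mulr1 -scalerAr !coefD coefMXn coefZ coefMX.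
rewrite coefXn coefC.
case: i => [|i] /=; first by rewrite mulr0 !add0r.
rewrite addr0; have [lin|ltni] := leqP i n.
  have := rec i lin; case: i lin => [|i] lin /=.
    by rewrite !add0r.
  by rewrite !subSS subn0 => ->; case: eqP => // ?; lia.
rewrite (P0 i ltni) (P0 i.+1) ?mulr0 ?addr0; last lia.
rewrite (_ : (i.+1 < 2)%N = false); last by lia.
rewrite !subSS.
have [->|ni] := eqVneq i n.+1; first by rewrite subSS subn0 Pn eqxx.
by rewrite P0; [case: eqP => // ?; lia|lia].
Qed.

(** [X^N + c] has no double root other than 0 in characteristic 0. *)
Lemma XnDC_simple_root (F : numFieldType) (N : nat) (c t : F) (r : {poly F}) :
  (0 < N)%N -> t != 0 -> 'X^N + c%:P != r * ('X - t%:P) * ('X - t%:P).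
Proof.
move=> N0 t0; apply/eqP => /(congr1 (fun p => (deriv p).[t])).
rewrite derivD derivXn derivC !derivM !derivXsubC !hornerE /= subrr.
rewrite !(mulr0, addr0, mulr1, hornerMn, hornerXn) => /eqP.
by rewrite mulrn_eq0 expf_eq0 (negPf t0) andbF orbF; case: N N0.
Qed.

(** * Necessity, nodes and weights *)

(** A root [w] of [X^2 + omega X + 1]; the other one is [w^-1]. *)
Lemma quadratic_root (R : realType) (omega : R) :
  exists2 w : R[i], w != 0 & w + w^-1 = - omega%:C.
Proof.
pose w := (- omega%:C + sqrtc (omega%:C ^+ 2 - 4)) / 2.
have hw : w * (- omega%:C - w) = 1.
  have /eqP := sqr_sqrtc (omega%:C ^+ 2 - 4).
  rewrite /w -subr_eq0 => /eqP; move: (sqrtc _) => s hs.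
  apply/eqP; rewrite -subr_eq0 -(mulr0 (- 4^-1)) -hs; apply/eqP.
  by field; rewrite ?pnatr_eq0.
have w0 : w != 0.
  by apply/eqP => e; move/eqP: hw; rewrite e mul0r eq_sym oner_eq0.
exists w => //; apply: (mulfI w0).
by rewrite mulrDr divff // -hw; ring.
Qed.

Lemma quadratic_factor (F : fieldType) (w b : F) : w != 0 -> w + w^-1 = - b ->
  'X^2 + b *: 'X + 1 = ('X - w%:P) * ('X - w^-1%:P).
Proof.
move=> w0 hw; have -> : b = - (w + w^-1) by rewrite hw opprK.
rewrite scaleNr -mul_polyC polyCD mulrDl mulrBl !mulrBr -expr2 -polyCM divff //.
by rewrite polyC1; ring.
Qed.

(** Both roots of [X^2 + omega X + 1] are roots of [X^(n+2) + c]; their product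
    is 1, whence [c^2 = 1], and they are distinct. *)
Lemma regular_quadratic_root (R : realType) (n : nat) (omega : R)
    (X z : 'I_n -> R[i]) (w : R[i]) : (0 < n)%N ->
  regular_moment_solution (harmonic_moment 1 omega) X z ->
  w != 0 -> w + w^-1 = - omega%:C ->
  [/\ w ^+ n.+2 = - (node_poly z)`_0, w ^+ n.+2 * w ^+ n.+2 = 1 & w != w^-1].
Proof.
move=> n0 hreg w0 hw; have := node_poly_mul n0 hreg.
rewrite (quadratic_factor w0 hw); set c := (node_poly z)`_0 => E.
have r1 : w ^+ n.+2 = - c.
  move/(congr1 (horner^~ w)): E; rewrite !hornerM !hornerXsubC subrr.
  rewrite mul0r mulr0 hornerD hornerXn hornerC => /eqP.
  by rewrite eq_sym addr_eq0 => /eqP.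
have r2 : (w^-1) ^+ n.+2 = - c.
  move/(congr1 (horner^~ w^-1)): E; rewrite !hornerM !hornerXsubC subrr.
  rewrite !mulr0 hornerD hornerXn hornerC => /eqP.
  by rewrite eq_sym addr_eq0 => /eqP.
split => //.
  by rewrite {1}r1 -r2 -exprMn mulVf // expr1n.
apply/eqP => e; have := XnDC_simple_root c (node_poly z) (ltn0Sn n.+1) w0.
by rewrite -E -e mulrA eqxx.
Qed.

Lemma sqr_eq1_norm (F : numDomainType) (N : nat) (w : F) : (0 < N)%N ->
  w ^+ N * w ^+ N = 1 -> `|w| = 1.
Proof.
move=> N0 h; apply/eqP; rewrite -(@pexpr_eq1 _ _ (N + N)) ?addn_gt0 ?N0 //.
by rewrite -normrX exprD h normr1.
Qed.

(** The roots of [X^2 + omega X + 1] lie on the unit circle, and their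
    arguments are multiples of [pi / (n + 2)] because [w^(n+2) = 1] or [-1]. *)
Lemma regular_moment_Omega (R : realType) (n : nat) (omega : R)
    (X z : 'I_n -> R[i]) : (0 < n)%N ->
  regular_moment_solution (harmonic_moment 1 omega) X z -> Omega n.+1 omega.
Proof.
move=> n0 hreg; have [w w0 hw] := quadratic_root omega.
have [_ hsq hne] := regular_quadratic_root n0 hreg w0 hw.
have [t ht tw] := unit_circle_arg (sqr_eq1_norm (ltn0Sn n.+1) hsq).
have tsq : expi t ^+ n.+2 * expi t ^+ n.+2 = 1.
  case: tw hsq => -> //; rewrite expiN !exprVn -invfM => /eqP.
  by rewrite invr_eq1 => /eqP.
have tne : expi t != (expi t)^-1.
  by case: tw hne => -> //; rewrite expiN invrK eq_sym.
have thw : expi t + (expi t)^-1 = - omega%:C.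
  by case: tw hw => -> //; rewrite expiN invrK addrC.
have omE : omega = - (2 * cos t).
  by move: thw; rewrite expiDN -rmorphN => /complexI ->; rewrite opprK.
have st : sin (n.+2%:R * t) = 0.
  have := tsq; rewrite -expiMn; move/(congr1 (@complex.Re R)) => /=.
  have := cos2Dsin2 (n.+2%:R * t); set u := cos _; set v := sin _; nra.
have [k kN tE] := expi_exp_real (ltn0Sn _) ht st.
have N0 : n.+2%:R != 0 :> R by rewrite pnatr_eq0.
have k0 : k != 0%N.
  by apply: contraNneq tne => k0; rewrite tE k0 mulr0 mul0r expi0 invr1.
have kn : k != n.+2.
  by apply: contraNneq tne => kn; rewrite tE kn mulfK // expi_pi invrN1.
exists (n.+2 - k)%N; first by rewrite /=; lia.
have -> : pi * (n.+2 - k)%:R / n.+2%:R = - t + pi :> R.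
  by rewrite natrB // tE; move: (n.+2%:R) N0 => N N0; field.
by rewrite cosDpi cosN omE mulrN.
Qed.

Lemma expi_node (R : realType) (N alpha : nat) : (0 < N)%N ->
  expi (pi * alpha%:R / N%:R : R) ^+ N = (-1) ^+ alpha.
Proof.
move=> N0; rewrite -expiMn.
have -> : N%:R * (pi * alpha%:R / N%:R) = alpha%:R * pi :> R.
  by field; rewrite pnatr_eq0 -lt0n.
by rewrite expiMn expi_pi.
Qed.

Lemma regular_moment_nodes (R : realType) (n alpha : nat)
    (X z : 'I_n -> R[i]) :
  let phi : R := pi * alpha%:R / n.+2%:R in
  (0 < n)%N ->
  regular_moment_solution (harmonic_moment 1 (- (2 * cos phi))) X z ->
  range z = [set t : R[i] | t ^+ n.+2 = (-1) ^+ alpha]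
              `\` [set expi phi; expi (- phi)].
Proof.
move=> phi n0 hreg; set w := expi phi.
have w0 : w != 0 := expi_neq0 phi.
have hw : w + w^-1 = - (- (2 * cos phi))%:C by rewrite expiDN -rmorphN opprK.
have [wc _ _] := regular_quadratic_root n0 hreg w0 hw.
have := node_poly_mul n0 hreg; rewrite (quadratic_factor w0 hw).
rewrite expi_node // in wc.
rewrite (_ : _`_0 = - (-1) ^+ alpha); last by rewrite wc opprK.
move=> E; rewrite expiN -/w.
have simple (p : {poly R[i]}) (t : R[i]) : t != 0 -> root p t ->
    p * ('X - t%:P) != 'X^(n.+2) + (- (-1) ^+ alpha)%:P.
  move=> t0 /factor_theorem[q ->]; rewrite eq_sym.
  exact: XnDC_simple_root.
have [_ _ nz _] := hreg.
apply/seteqP; split => t /=.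
  case=> j _ <-; have rz : root (node_poly z) (z j).
    by rewrite root_node_poly; apply/existsP; exists j.
  split.
    move/(congr1 (horner^~ (z j))): E; rewrite hornerM (rootP rz) mul0r.
    by rewrite hornerD hornerXn hornerC => /esym/eqP; rewrite subr_eq0 => /eqP.
  have zj0 : z j != 0 by rewrite -normr_eq0 nz oner_eq0.
  case=> e.
    have := simple (node_poly z * ('X - w^-1%:P)) (z j) zj0.
    rewrite rootM rz => /(_ isT)/eqP; apply; rewrite -E e; ring.
  have := simple (node_poly z * ('X - w%:P)) (z j) zj0.
  by rewrite rootM rz => /(_ isT)/eqP; apply; rewrite -E e; ring.
case=> ht hne.
have : root (node_poly z) t; last first.
  by rewrite root_node_poly => /existsP[j /eqP ->]; exists j.
have : root ('X^(n.+2) + (- (-1) ^+ alpha)%:P) t.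
  by rewrite /root hornerD hornerXn hornerC ht subrr.
rewrite -E !rootM !root_XsubC => /or3P[//|/eqP e|/eqP e]; case: hne;
  [by left|by right].
Qed.

(** The weights: pairing the moments [-1 <= l <= n] with the polynomial
    [\sum_(m < n + 2) (x / z k)^m], which vanishes at every [(n+2)]-th root of
    [z k ^+ n.+2] except [z k], isolates [X k]. *)
Lemma moment_weight (R : realType) (n : nat) (omega : R)
    (X z : 'I_n -> R[i]) (c : R[i]) (k : 'I_n) : (2 <= n)%N ->
  regular_moment_solution (harmonic_moment 1 omega) X z ->
  (forall j, z j ^+ n.+2 = c) ->
  X k = (z k + omega%:C + (z k)^-1) / n.+2%:R.
Proof.
move=> n2 [hX injz nz _] hc.
have z0 j : z j != 0 by rewrite -normr_eq0 nz oner_eq0.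
pose f := \poly_(m < n.+2) ((z k)^-1 ^+ m).
have fE t : f.[t] = \sum_(m < n.+2) (t / z k) ^+ m.
  by rewrite horner_poly; apply: eq_bigr => m _; rewrite exprMn mulrC.
have fk : f.[z k] = n.+2%:R.
  rewrite fE divff //; under eq_bigr => m _ do rewrite expr1n.
  by rewrite sumr_const card_ord.
have fj j : j != k -> f.[z j] = 0.
  move=> jk; have /eqP := subrX1 (z j / z k) n.+2.
  rewrite -fE exprMn exprVn !hc divff; last by rewrite -(hc j) expf_neq0.
  rewrite subrr eq_sym mulf_eq0 subr_eq0 => /orP[/eqP e|/eqP//].
  case/eqP: jk; apply: injz.
  by rewrite -[LHS](divfK (z0 k)) e mul1r.
have : \sum_(j < n) X j * z j ^ (- 1) * f.[z j] =
    \sum_(m < n.+2) f`_m * harmonic_moment 1 omega (m%:Z - 1%:Z).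
  apply: moment_horner => //; last exact: size_poly.
  by move=> m mn; apply: hX; lia.
rewrite (bigD1 k) //= big1 => [|j jk]; last by rewrite fj ?mulr0.
rewrite (@sum_harmonic_moment1 _ _ _ 1 (fun m => f`_m)) //; last first.
  by rewrite coef_poly ltnn.
rewrite fk addr0 !coef_poly /= ifT; last by lia.
rewrite expr0 expr1 exprN1 => E.
have : n.+2%:R != 0 :> R[i] by rewrite pnatr_eq0.
move: (n.+2%:R) E => N E N0.
apply: (mulIf (invr_neq0 (z0 k))); apply: (mulIf N0).
by rewrite E; field; rewrite z0 N0.
Qed.

(** * Existence of real solutions *)

(** Power sums over the coset [w * mu_N] of the [N]-th roots of unity. *)
Lemma sum_rotated_unity_roots (F : fieldType) (N : nat) (w zeta : F) (l : int) :
  w != 0 -> zeta != 0 -> zeta ^+ N = 1 ->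
  (forall k : nat, (0 < k < N)%N -> zeta ^+ k != 1) -> (`|l| < N)%N ->
  \sum_(k < N) (w * zeta ^+ k) ^ l = N%:R * (l == 0)%:R.
Proof.
move=> w0 z0 zN zk lN; have [->|l0] := eqVneq l 0.
  under eq_bigr => k _ do rewrite expr0z.
  by rewrite sumr_const card_ord mulr1.
have yN : (zeta ^ l) ^+ N = 1 by rewrite exprnP exprzAC -exprnP zN exp1rz.
have y1 : zeta ^ l != 1.
  have /zk : (0 < `|l| < N)%N by lia.
  case: l l0 {lN yN} => m _; first by [].
  by rewrite /= NegzE -exprnN invr_eq1.
have := subrX1 (zeta ^ l) N; rewrite yN subrr => /esym/eqP.
rewrite mulf_eq0 subr_eq0 (negPf y1) /= => /eqP y0.
transitivity (w ^ l * \sum_(i < N) (zeta ^ l) ^+ i); last by rewrite y0 !mulr0.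
rewrite mulr_sumr; apply: eq_bigr => k _.
by rewrite exprzMl ?unitfE ?expf_neq0 // !exprnP exprzAC.
Qed.

(** The nodes are the points [e^(i th k)] of the coset of the [n+2]-th roots of
    unity through [e^(i phi)], where [omega = - 2 cos phi], without
    [e^(i phi)] and [e^(-i phi)]. *)
Lemma real_moment_solution (R : realType) (n alpha : nat) :
  (2 <= n)%N -> (1 <= alpha <= n.+1)%N ->
  exists X lam : 'I_n -> R, regular_moment_solution
    (harmonic_moment 1 (2 * cos (pi * alpha%:R / n.+2%:R)))
    (fun j => (X j)%:C) (fun j => expi (- lam j)).
Proof.
move=> n2 /andP[a1 an]; set psi : R := pi * alpha%:R / n.+2%:R.
set omega := 2 * cos psi.
pose phi := pi - psi.
pose d : R := 2 * pi / n.+2%:R.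
pose th (k : nat) : R := phi + k%:R * d.
pose t (k : nat) : R[i] := expi (th k).
have N0 : n.+2%:R != 0 :> R by rewrite pnatr_eq0.
have Npos : 0 < n.+2%:R :> R by rewrite ltr0n.
have tE k : t k = expi phi * expi d ^+ k by rewrite /t expiD expiMn.
have t_neq0 k : t k != 0 by apply: expi_neq0.
have zN : expi d ^+ n.+2 = 1.
  have -> : d = 2 * (pi / n.+2%:R) by rewrite /d mulrA.
  rewrite -expiMn mulrCA (mulrCA n.+2%:R) divff // mulr1.
  by rewrite expiMn expi_pi sqrrN expr1n.
have zk k : (0 < k < n.+2)%N -> expi d ^+ k != 1.
  move=> /andP[k0 kN]; rewrite -expiMn.
  have -> : k%:R * d = 2 * (pi * k%:R / n.+2%:R) by rewrite /d; ring.
  apply: expi_double_neq1; rewrite divr_gt0 ?mulr_gt0 ?pi_gt0 ?ltr0n //=.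
  by rewrite ltr_pdivrMr // ltr_pM2l ?pi_gt0 // ltr_nat.
have psum l : (`|l| < n.+2)%N ->
    \sum_(k < n.+2) t k ^ l = n.+2%:R * (l == 0)%:R.
  move=> lN; under eq_bigr => k _ do rewrite tE.
  by apply: sum_rotated_unity_roots; rewrite ?expi_neq0.
have t_inj k m : (k < n.+2)%N -> (m < n.+2)%N -> t k = t m -> k = m.
  wlog km : k m / (k <= m)%N.
    by move=> H kN mN e; case/orP: (leq_total k m) => h; [|symmetry]; apply: H.
  move=> kN mN; rewrite !tE => /(mulfI (expi_neq0 _)) e.
  apply/eqP; rewrite eqn_leq km /= leqNgt; apply/negP => lkm.
  have /zk/eqP : (0 < m - k < n.+2)%N by lia.
  apply; apply: (mulfI (expf_neq0 k (expi_neq0 d))).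
  by rewrite -exprD subnKC // mulr1.
(* [t 0] and [t alpha] are the two roots of [X^2 + omega X + 1]. *)
have t0E : t 0%N = expi phi by rewrite /t /th mul0r addr0.
have taE : t alpha = (t 0%N)^-1.
  rewrite t0E /t (_ : th alpha = - phi + 2 * pi).
    by rewrite expiD expiN expiMn expi_pi sqrrN expr1n mulr1.
  by rewrite /th /d /phi /psi; move: (n.+2%:R) N0 => N N0; field.
have quad k : t k + omega%:C + (t k)^-1 =
    (t k)^-1 * ((t k - t 0%N) * (t k - t alpha)).
  have -> : omega%:C = - (t 0%N + (t 0%N)^-1).
    by rewrite t0E expiDN /phi -rmorphN addrC cosDpi cosN mulrN opprK.
  by rewrite taE; field; rewrite !t_neq0.
pose G (l : int) (k : nat) := (t k + omega%:C + (t k)^-1) / n.+2%:R * t k ^ l.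
have alt : (alpha.-1 < n.+1)%N by lia.
pose a : 'I_n.+1 := Ordinal alt.
(* The index [k j] enumerates [1, ..., n + 1] without [alpha]. *)
pose k (j : 'I_n) : 'I_n.+2 := lift ord0 (lift a j).
have k_neq0 j : k j != 0%N :> nat by rewrite lift0.
have k_neqa j : k j != alpha :> nat.
  have := neq_lift a j; rewrite lift0 -val_eqE /= => h.
  by apply: contraNneq h => e; apply/eqP; rewrite -[in LHS]e.
have sumG l : \sum_(j < n) G l (k j) = \sum_(i < n.+2) G l i.
  rewrite (bigD1_ord ord0) // (bigD1_ord a) //= -/(k _).
  have -> : G l 0%N = 0 by rewrite /G quad subrr mul0r mulr0 !mul0r.
  have -> : G l (bump 0 alpha.-1) = 0.
    by rewrite /bump add1n prednK // /G quad subrr !mulr0 !mul0r.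
  by rewrite !add0r.
exists (fun j => (2 * cos (th (k j)) + omega) / n.+2%:R), (fun j => - th (k j)).
have XE j : ((2 * cos (th (k j)) + omega) / n.+2%:R)%:C =
    (t (k j) + omega%:C + (t (k j))^-1) / n.+2%:R.
  by rewrite rmorphM fmorphV rmorph_nat rmorphD /= -expiDN addrAC.
split.
- move=> l l1 l2; under eq_bigr => j _ do rewrite XE opprK -/(t _) -/(G l _).
  rewrite sumG /G.
  have NC0 : n.+2%:R != 0 :> R[i] by rewrite pnatr_eq0.
  under eq_bigr => i _.
    rewrite (_ : _ * _ = n.+2%:R^-1 *
      (t i ^ (l + 1) + omega%:C * t i ^ l + t i ^ (l - 1))); last first.
      by rewrite !expfzDr // expr1z exprN1; ring.
    over.
  rewrite -mulr_sumr !big_split /= -mulr_sumr !psum; [|lia..].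
  rewrite mulrCA -!mulrDr mulKf // /harmonic_moment.
  have [->|l0] := eqVneq l 0; first by rewrite mulr1 add0r addr0.
  rewrite mulr0 addr0; case: ifPn => h.
    have [->|->] : l = 1 \/ l = -1 by lia.
      by rewrite add0r.
    by rewrite addr0.
  have -> : (l + 1 == 0) = false by lia.
  have -> : (l - 1 == 0) = false by lia.
  by rewrite addr0.
- move=> i j; rewrite /= !opprK => e; apply/(@lift_inj _ a)/(@lift_inj _ ord0).
  exact/val_inj/(t_inj _ _ (ltn_ord (k i)) (ltn_ord (k j)) e).
- by move=> j; apply: norm_expi.
move=> j; rewrite XE quad !mulf_neq0 ?invr_eq0 ?pnatr_eq0 // subr_eq0.
  by apply/eqP => /t_inj e; have := k_neq0 j; rewrite e ?eqxx.
by apply/eqP => /t_inj e; have := k_neqa j; rewrite e ?eqxx // ltnS.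
Qed.

(** * Extraction and moments *)

Lemma sum_complex (R : rcfType) (n : nat) (u v : 'I_n -> R) :
  \sum_(j < n) (u j +i* v j) = (\sum_(j < n) u j) +i* (\sum_(j < n) v j).
Proof. by elim/big_rec3: _ => // j x y z _ ->. Qed.

Lemma sum_harmonic_shift (R : realType) (n k : nat) (X lam : 'I_n -> R)
    (a b : nat -> R) (x : R) :
  \sum_(j < n) X j * harmonic a b k (x - lam j) =
  (\sum_(j < n) X j * cos (k%:R * lam j)) * harmonic a b k x +
  (\sum_(j < n) X j * sin (k%:R * lam j)) *
    (a k * sin (k%:R * x) - b k * cos (k%:R * x)).
Proof.
rewrite !mulr_suml -big_split /=; apply: eq_bigr => j _.
by rewrite /harmonic mulrBr cosB sinB; ring.
Qed.

(** Extraction of the first harmonic amounts to the moment equations with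
    [1 <= l <= n] for the nodes [e^(-i lam)]. *)
Lemma extraction_moments (R : realType) (n : nat) (X lam : 'I_n -> R) :
  (0 < n)%N ->
  admissible_extraction 1 X lam <->
  forall k : nat, (1 <= k <= n)%N ->
    \sum_(j < n) (X j)%:C * expi (- lam j) ^+ k = (k == 1%N)%:R.
Proof.
move=> n0.
pose C k := \sum_(j < n) X j * cos (k%:R * lam j).
pose S k := \sum_(j < n) X j * sin (k%:R * lam j).
have sumE k : \sum_(j < n) (X j)%:C * expi (- lam j) ^+ k = C k +i* - S k.
  rewrite /C /S -sumrN -sum_complex; apply: eq_bigr => j _.
  rewrite -expiMn mulrN /expi cosN sinN; apply/eqP.
  by rewrite eq_complex /= !mul0r subr0 addr0 mulrN !eqxx.
have extE a b x : \sum_(j < n) X j * trig_poly n a b (x - lam j) =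
    \sum_(1 <= k < n.+1) (C k * harmonic a b k x +
      S k * (a k * sin (k%:R * x) - b k * cos (k%:R * x))).
  under eq_bigr => j _ do rewrite mulr_sumr.
  by rewrite exchange_big /=; apply: eq_bigr => k _; rewrite sum_harmonic_shift.
split=> [hX k kn|hX a b x].
  (* Test the extraction on [cos (k x)] and [sin (k x)] at [x = 0]. *)
  have at0 a b : a 1%N = \sum_(1 <= m < n.+1) (C m * a m - S m * b m).
    have := hX a b 0; rewrite extE /harmonic mulr0 cos0 sin0 mulr1 mulr0 addr0.
    move=> ->; apply: eq_bigr => m _.
    by rewrite mulr0 cos0 sin0; ring.
  have pick (f : nat -> R) :
      \sum_(1 <= m < n.+1) f m * (m == k)%:R = f k.
    rewrite (bigD1_seq k) ?mem_index_iota ?iota_uniq //=.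
    by rewrite eqxx mulr1 big1 ?addr0 // => m /negPf->; rewrite mulr0.
  have Ck : C k = (k == 1%N)%:R.
    rewrite eq_sym (at0 (fun m => (m == k)%:R) (fun=> 0)).
    by under eq_bigr => m _ do rewrite mulr0 subr0; rewrite pick.
  have Sk : S k = 0.
    rewrite -pick; apply/eqP; rewrite -oppr_eq0 -sumrN; apply/eqP.
    rewrite [RHS](at0 (fun=> 0) (fun m => (m == k)%:R)).
    by apply: eq_bigr => m _; rewrite mulr0 sub0r.
  by rewrite sumE Ck Sk oppr0; case: (k == 1%N).
rewrite extE big_nat_recl // [X in _ + X]big1_seq ?addr0.
  have := hX 1%N; rewrite sumE n0 => /(_ isT) [-> /eqP].
  by rewrite oppr_eq0 => /eqP->; rewrite mul1r mul0r addr0.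
move=> m; rewrite mem_index_iota => /andP[_ mn].
have := hX m.+1; rewrite sumE => /(_ ltac:(lia)).
have -> : (m.+1 == 1%N) = false by lia.
by case=> -> /eqP; rewrite oppr_eq0 => /eqP->; rewrite !mul0r addr0.
Qed.

(** The equation [l = 0] is the condition on the sum of the weights, and those
    with [l < 0] are conjugate to those with [l > 0], the weights being real. *)
Lemma extraction_moment_solution (R : realType) (n : nat) (omega : R)
    (X lam : 'I_n -> R) : (0 < n)%N ->
  (regular_admissible_extraction 1 X lam /\ \sum_(j < n) X j = omega) <->
  regular_moment_solution (harmonic_moment 1 omega)
    (fun j => (X j)%:C) (fun j => expi (- lam j)).
Proof.
move=> n0.
have injE : injective (fun j => expi (lam j)) <->
    injective (fun j => expi (- lam j)).
  by split=> inj i j /(congr1 (fun t : R[i] => t^*));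
    rewrite !conjc_expi ?opprK => /inj.
have nzE j : ((X j)%:C != 0) = (X j != 0).
  by rewrite fmorph_eq0.
split=> [[[hX inj nz] hS]|[hX inj _ nz]].
  split; [|exact/injE|by move=> j; apply: norm_expi|by move=> j; rewrite nzE].
  have /extraction_moments hm := hX.
  have pos (k : nat) : (k <= n)%N ->
      \sum_(j < n) (X j)%:C * expi (- lam j) ^ k%:Z = harmonic_moment 1 omega k.
    case: k => [|k] kn.
      under eq_bigr => j _ do rewrite expr0z mulr1.
      by rewrite -rmorph_sum /= hS.
    under eq_bigr => j _ do rewrite -exprnP.
    by rewrite hm // /harmonic_moment /=; case: eqP.
  move=> l l1 l2; case: (intP l) l1 l2 => [_ _|k _ kn|k kn _].
  - exact: (pos 0%N).
  - exact: (pos k.+1).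
  rewrite harmonic_momentN -conjc_harmonic_moment -pos; last by lia.
  rewrite rmorph_sum /=; apply: eq_bigr => j _.
  rewrite rmorphM; congr (_ * _); first exact/esym/conjc_real.
  exact/esym/conjc_exprz/norm_expi.
have mom (k : nat) : (k <= n)%N ->
    \sum_(j < n) (X j)%:C * expi (- lam j) ^+ k = harmonic_moment 1 omega k.
  by move=> kn; rewrite -hX //; lia.
split; first split.
- apply/extraction_moments => // k /andP[k0 kn]; rewrite mom //.
  by case: k k0 {kn} => // k _; rewrite /harmonic_moment /=; case: eqP.
- exact/injE.
- by move=> j; rewrite -nzE.
apply: complexI; rewrite rmorph_sum; transitivity (harmonic_moment 1 omega 0).
  by rewrite -(mom 0%N) //; apply: eq_bigr => j _; rewrite expr0 mulr1.
by rewrite /harmonic_moment eqxx.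
Qed.

(** * The characterization *)

Unset Implicit Arguments.

Theorem theorem3 (R : realType) (n : nat) (hn : (2 <= n)%N) (omega : R) :
  [/\ (exists X z : 'I_n -> R[i],
         regular_moment_solution (harmonic_moment 1 omega) X z)
      <-> Omega n.+1 omega,
      (exists X lam : 'I_n -> R,
         regular_admissible_extraction 1 X lam /\ \sum_(j < n) X j = omega)
      <-> Omega n.+1 omega
    & forall alpha : nat, (1 <= alpha <= n.+1)%N ->
      let phi : R := pi * alpha%:R / n.+2%:R in
      omega = - (2 * cos phi) ->
      forall X z : 'I_n -> R[i],
        regular_moment_solution (harmonic_moment 1 omega) X z ->
        range z = [set t : R[i] | t ^+ n.+2 = (-1) ^+ alpha]
                    `\` [set expi phi; expi (- phi)]
        /\ forall k : 'I_n,
          X k = - ((Num.sg (sin (n.+1%:R * phi)))%:C / n.+2%:R)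
                * ((z k ^+ 2 - 2 * z k * (cos phi)%:C + 1) / z k ^+ (n + 3))].
Proof.
have n0 : (0 < n)%N by apply: leq_trans hn.
split.
- split=> [[X [z]]|[alpha /= ha <-]]; first exact: regular_moment_Omega.
  have [X [lam h]] := real_moment_solution R hn ha.
  by exists (fun j => (X j)%:C), (fun j => expi (- lam j)).
- split=> [[X [lam /(extraction_moment_solution _ _ _ n0)]]|[alpha /= ha <-]].
    exact: regular_moment_Omega.
  have [X [lam h]] := real_moment_solution R hn ha.
  by exists X, lam; apply/extraction_moment_solution.
move=> alpha ha phi omE X z hreg; rewrite omE in hreg.
have hz := regular_moment_nodes n0 hreg; split=> // k.
have hc j : z j ^+ n.+2 = (-1) ^+ alpha.
  have : range z (z j) by exists j.
  by rewrite hz => -[].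
have [_ _ nz _] := hreg.
have z0 : z k != 0 by rewrite -normr_eq0 nz oner_eq0.
have sgE : Num.sg (sin (n.+1%:R * phi)) = - (-1) ^+ alpha.
  have N0 : n.+2%:R != 0 :> R by rewrite pnatr_eq0.
  have -> : n.+1%:R * phi = alpha%:R * pi - phi.
    rewrite /phi; move: N0; rewrite -[n.+2%:R]natr1.
    by move: (n.+1%:R) => m m0; field.
  have : expi (alpha%:R * pi : R) = ((-1) ^+ alpha)%:C.
    by rewrite expiMn expi_pi rmorphXn /= rmorphN1.
  case=> ca sa; rewrite sinB ca sa mul0r sub0r sgrN sgrM sgrX sgrN1.
  rewrite gtr0_sg ?mulr1 // sin_gt0_pi // divr_gt0 ?mulr_gt0 ?pi_gt0 ?ltr0n //=.
    by rewrite ltr_pdivrMr ?ltr0n // ltr_pM2l ?pi_gt0 // ltr_nat; lia.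
  by lia.
rewrite (moment_weight k hn hreg hc) sgE addn3 (exprSr (z k) n.+2) hc.
rewrite !rmorphN rmorphM rmorphXn /= rmorphN1 rmorph_nat.
have NC0 : n.+2%:R != 0 :> R[i] by rewrite pnatr_eq0.
have e0 : (-1) ^+ alpha != 0 :> R[i] by rewrite expf_neq0 // oppr_eq0 oner_eq0.
move: (n.+2%:R) ((-1) ^+ alpha) NC0 e0 => N e NC0 e0.
by field; rewrite NC0 z0 e0.
Qed.
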